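(* For all $n\ge 0$, the $K$-linear span $\mathcal{P}_n$ of the elements $$\Pi^P:=\sum_{\pi\in S_n,\ \mathrm{Peak}(\pi)=P}\pi,\qquad P\subseteq\{2,\ldots,n-1\},$$ is a left ideal of the descent algebra $\mathcal{D}_n$, and $\dim_K\mathcal{P}_n=f_n$, where $f_0=f_1=f_2=1$ and $f_n=f_{n-1}+f_{n-2}$ for all $n>2$.
   Context: $K$ is a field of characteristic $0$. Permutations act on the right, so $i\pi$ is the image of $i$ under $\pi$, and products $\pi\sigma$ in the symmetric group $S_n$ are read from left to right (first $\pi$, then $\sigma$). For $\pi\in S_n$, $\mathrm{Des}(\pi):=\{i\mid 1\le i\le n-1,\ i\pi>(i+1)\pi\}$ and $\mathrm{Peak}(\pi):=\{i\mid 2\le i\le n-1,\ (i-1)\pi<i\pi>(i+1)\pi\}$. $\mathcal{D}_n$ is the $K$-linear span in the group algebra $KS_n$ of the elements $\Delta^D:=\sum_{\mathrm{Des}(\pi)=D}\pi$, $D\subseteq\{1,\ldots,n-1\}$; by a theorem of Solomon it is a subalgebra of $KS_n$ (the descent algebra). A left ideal of $\mathcal{D}_n$ is a linear subspace $I\subseteq\mathcal{D}_n$ with $\mathcal{D}_nI\subseteq I$. $S_0$ is the trivial group consisting of the empty permutation. *)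

(* Defs.v *)
From HB Require Import structures.
From mathcomp Require Import all_boot all_order all_algebra all_fingroup all_field.

Set Implicit Arguments.
Unset Strict Implicit.
Unset Printing Implicit Defensive.

Import GroupScope GRing.Theory.
Local Open Scope ring_scope.

(* The group algebra K[G]: its vector space structure is that of functions
   G -> K, its product is convolution.  It must be kept distinct from
   {ffun gT -> K}, on which the canonical product is pointwise. *)
Definition group_alg (K : fieldType) (gT : finGroupType) : Type :=
  {ffun gT -> K^o}.

Section GroupAlgebra.
Variables (K : fieldType) (gT : finGroupType).
Local Notation KG := (group_alg K gT).

HB.instance Definition _ := Vector.copy KG {ffun gT -> K^o}.

Definition gaval (a : KG) (g : gT) : K := (a : {ffun gT -> K^o}) g.

Definition ga_delta (g : gT) : KG := [ffun h => (h == g)%:R : K^o].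

Definition ga_mul (a b : KG) : KG :=
  [ffun g => \sum_(x : gT * gT | (x.1 * x.2)%g == g)
               gaval a x.1 * gaval b x.2 : K^o].

Fact gaP (a b : KG) : gaval a =1 gaval b -> a = b.
Proof. by move=> eq_ab; apply/ffunP=> g; apply: eq_ab. Qed.

Fact gavalD (a b : KG) g : gaval (a + b) g = gaval a g + gaval b g.
Proof. by rewrite /gaval ffunE. Qed.

Fact gavalZ k (a : KG) g : gaval (k *: a) g = k * gaval a g.
Proof. by rewrite /gaval ffunE. Qed.

Fact gaval_delta h g : gaval (ga_delta h) g = (g == h)%:R.
Proof. by rewrite /gaval ffunE. Qed.

Fact gaval_mul (a b : KG) g :
  gaval (ga_mul a b) g = \sum_x gaval a x * gaval b (x^-1 * g)%g.
Proof.
rewrite {1}/gaval ffunE.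
rewrite -(pair_big_dep xpredT (fun x y => (x * y)%g == g)
            (fun x y => gaval a x * gaval b y)) /=.
apply: eq_bigr => x _; rewrite (big_pred1 (x^-1 * g)%g) // => y.
by rewrite -[RHS](can_eq (mulKg x)) mulKVg.
Qed.

Fact ga_mulA : associative ga_mul.
Proof.
move=> a b c; apply: gaP => g; rewrite !gaval_mul.
under eq_bigr do rewrite gaval_mul big_distrr /=.
under [RHS]eq_bigr do rewrite gaval_mul big_distrl /=.
rewrite [RHS]exchange_big /=; apply: eq_bigr => x _.
rewrite [RHS](reindex_inj (mulgI x)) /=; apply: eq_bigr => y _.
by rewrite mulrA mulKg invMg mulgA.
Qed.

Fact ga_mul1l : left_id (ga_delta 1%g) ga_mul.
Proof.
move=> a; apply: gaP => g; rewrite gaval_mul (bigD1 1%g) //= big1 => [|x x1].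
  by rewrite gaval_delta eqxx mul1r invg1 mul1g addr0.
by rewrite gaval_delta (negPf x1) mul0r.
Qed.

Fact ga_mul1r : right_id (ga_delta 1%g) ga_mul.
Proof.
move=> a; apply: gaP => g; rewrite gaval_mul (bigD1 g) //= big1 => [|x xg].
  by rewrite gaval_delta mulVg eqxx mulr1 addr0.
by rewrite gaval_delta -eq_mulVg1 (negPf xg) mulr0.
Qed.

Fact ga_mulDl : left_distributive ga_mul +%R.
Proof.
move=> a b c; apply: gaP => g; rewrite gavalD !gaval_mul -big_split /=.
by apply: eq_bigr => x _; rewrite gavalD mulrDl.
Qed.

Fact ga_mulDr : right_distributive ga_mul +%R.
Proof.
move=> a b c; apply: gaP => g; rewrite gavalD !gaval_mul -big_split /=.
by apply: eq_bigr => x _; rewrite gavalD mulrDr.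
Qed.

Fact ga_1neq0 : ga_delta 1%g != 0.
Proof.
apply/eqP=> /ffunP/(_ 1%g); rewrite !ffunE eqxx; apply/eqP; exact: oner_neq0.
Qed.

HB.instance Definition _ := GRing.Zmodule_isNzRing.Build KG
  ga_mulA ga_mul1l ga_mul1r ga_mulDl ga_mulDr ga_1neq0.

Fact ga_scaleAl k (a b : KG) : k *: (a * b) = (k *: a) * b.
Proof.
apply: gaP => g; rewrite gavalZ !gaval_mul big_distrr /=.
by apply: eq_bigr => x _; rewrite gavalZ mulrA.
Qed.

HB.instance Definition _ := GRing.Lmodule_isLalgebra.Build K KG ga_scaleAl.

Fact ga_scaleAr k (a b : KG) : k *: (a * b) = a * (k *: b).
Proof.
apply: gaP => g; rewrite gavalZ !gaval_mul big_distrr /=.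
by apply: eq_bigr => x _; rewrite gavalZ mulrCA.
Qed.

HB.instance Definition _ := GRing.Lalgebra_isAlgebra.Build K KG ga_scaleAr.
HB.instance Definition _ := Algebra_isFalgebra.Build K KG.

Lemma ga_deltaM g h : ga_delta g * ga_delta h = ga_delta (g * h)%g.
Proof.
apply: gaP => x; rewrite gaval_mul (bigD1 g) //= big1 => [|y yg].
  by rewrite !gaval_delta eqxx mul1r addr0 -[in LHS](can_eq (mulKg g)) mulKVg.
by rewrite gaval_delta (negPf yg) mul0r.
Qed.

End GroupAlgebra.

(* In MathComp, (p * s) i = s (p i) for p s : 'S_n, i.e. products of
   permutations are read from left to right.

   The letters 1, ..., n are represented by 'I_n through i |-> i - 1, both as
   arguments and as values of permutations and as elements of descent and peak
   sets. *)
Section DescentsAndPeaks.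
Variable n : nat.

Definition Des (p : 'S_n) : {set 'I_n} :=
  [set i : 'I_n | [exists j : 'I_n, (j == i.+1 :> nat) && (p j < p i)%N]].

Definition Peak (p : 'S_n) : {set 'I_n} :=
  [set i : 'I_n | [exists h : 'I_n, exists j : 'I_n,
     [&& i == h.+1 :> nat, j == i.+1 :> nat, (p h < p i)%N & (p j < p i)%N]]].

(* {1, ..., n-1} *)
Definition Des_range : {set 'I_n} := [set i : 'I_n | (i.+1 < n)%N].

(* {2, ..., n-1} *)
Definition Peak_range : {set 'I_n} :=
  [set i : 'I_n | (0 < i)%N && (i.+1 < n)%N].

Variable K : fieldType.

Definition Des_sum (D : {set 'I_n}) : group_alg K 'S_n :=
  \sum_(p : 'S_n | Des p == D) ga_delta K p.

Definition Peak_sum (P : {set 'I_n}) : group_alg K 'S_n :=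
  \sum_(p : 'S_n | Peak p == P) ga_delta K p.

Definition descent_algebra : {vspace group_alg K 'S_n} :=
  <<[seq Des_sum D | D in powerset Des_range]>>%VS.

Definition peak_space : {vspace group_alg K 'S_n} :=
  <<[seq Peak_sum P | P in powerset Peak_range]>>%VS.

End DescentsAndPeaks.

Definition left_ideal_of (K : fieldType) (A : falgType K)
    (D I : {vspace A}) : Prop :=
  (I <= D)%VS /\ {in D & I, forall d x, d * x \in I}.

(* Indexed so that f_0 = f_1 = f_2 = 1 (unlike the usual Fibonacci numbers,
   for which F_0 = 0). *)
Fixpoint fib (n : nat) : nat :=
  match n with
  | 0 | 1 | 2 => 1
  | (m.+1 as m').+1 => fib m' + fib m
  end.

(* Main.v *)
Require Import Defs.
From mathcomp Require Import all_boot all_order all_algebra all_fingroup all_field.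
From mathcomp Require Import zify.

Set Implicit Arguments.
Unset Strict Implicit.
Unset Printing Implicit Defensive.

Import GRing.Theory.

(* Exchanging the values v and v + 1 in a permutation t preserves its descents
   if these values are not in adjacent positions, and exchanging the two
   smallest values always preserves its peaks.  Any two permutations with the
   same peak set are linked by such exchanges.  Let t' be obtained from t by
   such an exchange.  The coefficient at t of the product of a descent class sum
   D and a peak class sum P counts the p with Des p = D and Peak (p^-1 t) = P.
   If v and v + 1 become adjacent in p^-1 t, then p has adjacent values at their
   positions in t, and exchanging those values of p makes up for the exchange
   in t; otherwise p itself can be kept.  So the coefficients at t and t' agree,
   and the product lies in the peak space.

   The peak sets are the subsets of {2, ..., n-1} without two consecutive
   elements, which are counted by Fibonacci numbers, and the corresponding class
   sums have disjoint supports. *)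

(** * Exchanges of adjacent values in a permutation *)

Section Swaps.
Variable n : nat.
Implicit Types (h i j k a b : 'I_n) (p q : 'S_n).

Definition adjacent i j := (i == j.+1 :> nat) || (j == i.+1 :> nat).

Lemma adjacentC i j : adjacent i j = adjacent j i.
Proof. exact: orbC. Qed.

Lemma adjacentS i j : j = i.+1 :> nat -> adjacent i j.
Proof. by move=> ji; rewrite /adjacent ji eqxx orbT. Qed.

Lemma mem_Des p i j : j = i.+1 :> nat -> (i \in Des p) = (p j < p i).
Proof.
move=> ji; rewrite inE; apply/existsP/idP => [[k /andP[/eqP ki]]|lt_ji].
  by rewrite (val_inj (etrans ki (esym ji)) : k = j).
by exists j; rewrite ji eqxx.
Qed.

Lemma mem_Peak p h i j : i = h.+1 :> nat -> j = i.+1 :> nat ->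
  (i \in Peak p) = (p h < p i) && (p j < p i).
Proof.
move=> ih ji; rewrite inE.
apply/existsP/idP.
  case=> h' /existsP[j' /and4P[/eqP ih' /eqP ji' lth ltj]].
  have -> : h = h' by apply: val_inj => /=; lia.
  have -> : j = j' by apply: val_inj => /=; lia.
  by rewrite lth.
by case/andP=> lth ltj; exists h; apply/existsP; exists j; rewrite -ih -ji !eqxx lth.
Qed.

Lemma PeakP p i : reflect
  (exists h, exists j, [/\ i = h.+1 :> nat, j = i.+1 :> nat, p h < p i & p j < p i])
  (i \in Peak p).
Proof.
rewrite inE; apply: (iffP existsP) => [[h /existsP[j /and4P[/eqP ? /eqP ? ? ?]]]|].
  by exists h, j.
by case=> h [j [/eqP ? /eqP ? ? ?]]; exists h; apply/existsP; exists j; apply/and4P.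
Qed.

Lemma DesP p i : reflect
  (exists2 j : 'I_n, j = i.+1 :> nat & p j < p i) (i \in Des p).
Proof.
rewrite inE; apply: (iffP existsP) => [[j /andP[/eqP ? ?]]|[j /eqP ? ?]].
  by exists j.
by exists j; apply/andP.
Qed.

Lemma Peak_Des p : Peak p \subset Des p.
Proof.
by apply/subsetP => i /PeakP[h [j [_ ji _ ltj]]]; apply/DesP; exists j.
Qed.

(** This form shows that the descent set determines the peak set. *)
Lemma Peak_DesE p i :
  (i \in Peak p) = (i \in Des p) &&
    [exists h : 'I_n, (i == h.+1 :> nat) && (h \notin Des p)].
Proof.
apply/PeakP/andP => [[h [j [ih ji lth ltj]]]|[/DesP[j ji ltj]]].
  split; first by apply/DesP; exists j.
  by apply/existsP; exists h; rewrite ih eqxx (mem_Des p ih) -leqNgt ltnW.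
case/existsP=> h /andP[/eqP ih]; rewrite (mem_Des p ih) -leqNgt leq_eqVlt.
case/orP=> [/eqP/val_inj/perm_inj eq_hi|lth]; last by exists h, j.
by move: ih; rewrite eq_hi => /eqP; rewrite -[X in X == _]addn0 -addn1 eqn_add2l.
Qed.

Lemma eq_Peak p q : Des p = Des q -> Peak p = Peak q.
Proof. by move=> eqD; apply/setP => i; rewrite !Peak_DesE eqD. Qed.

Lemma eq_Des p q :
  (forall i j, adjacent i j -> (p i < p j) = (q i < q j)) -> Des p = Des q.
Proof.
move=> eq_pq; apply/setP => i; rewrite !inE; apply: eq_existsb => j.
by case: eqP => //= ji; rewrite eq_pq // adjacentC adjacentS.
Qed.

(** No value lies strictly between [a] and [b], so only the comparison of these two with each other
    can change. *)
Lemma lt_tperm a b (x y : 'I_n) : adjacent a b ->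
  ~ (x = a /\ y = b) -> ~ (x = b /\ y = a) ->
  (tperm a b x < tperm a b y) = (x < y).
Proof.
move=> /orP ab nab nba.
have neq (u v : 'I_n) : u <> v -> u <> v :> nat by move=> nuv /val_inj.
case: tpermP => [xa|xb|/neq xa /neq xb]; case: tpermP => [ya|yb|/neq ya /neq yb];
  subst; rewrite ?ltnn //; try tauto; lia.
Qed.

Lemma lt_swap p a b i j : adjacent a b -> ~~ adjacent ((p^-1)%g a) ((p^-1)%g b) ->
  adjacent i j -> ((p * tperm a b)%g i < (p * tperm a b)%g j) = (p i < p j).
Proof.
move=> ab nab ij; rewrite !permM lt_tperm // => -[pi pj];
  by move: nab; rewrite -pi -pj !permK ?ij // adjacentC ij.
Qed.

Lemma Des_swap p a b : adjacent a b -> ~~ adjacent ((p^-1)%g a) ((p^-1)%g b) ->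
  Des (p * tperm a b)%g = Des p.
Proof. by move=> ab nab; apply: eq_Des => i j; apply: lt_swap. Qed.

(** Here [a] and [b] are the values 0 and 1. A peak value exceeds two others, hence is at least 2,
    and its comparisons with 0 and 1 are unaffected by the exchange. *)
Lemma Peak_swap01 p a b : a + b = 1 -> Peak (p * tperm a b)%g = Peak p.
Proof.
move=> ab1; apply/setP=> i; rewrite !inE.
apply: eq_existsb => h; apply: eq_existsb => j.
case: eqP => //= ih; case: eqP => //= ji; rewrite !permM.
have neq (u v : 'I_n) : u <> v -> u <> v :> nat by move=> nuv /val_inj.
have nhi : p h <> p i :> nat by move/val_inj/perm_inj => e; move: ih; rewrite e; lia.
have nji : p j <> p i :> nat by move/val_inj/perm_inj => e; move: ji; rewrite e; lia.
have nhj : p h <> p j :> nat by move/val_inj/perm_inj => e; move: ih ji; rewrite e; lia.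
case: tpermP => [x|x|/neq xa /neq xb]; case: tpermP => [y|y|/neq ya /neq yb];
  case: tpermP => [z|z|/neq za /neq zb]; rewrite ?x ?y ?z in nhi nji nhj *;
  lia.
Qed.

(** The target of [f] is arbitrary so as to cover both [Peak] and coefficient functions of group
    algebra elements. The condition [a + b == 1] singles out the two smallest values. *)
Definition swap_invariant (T : Type) (f : 'S_n -> T) :=
  forall p a b, adjacent a b ->
    (a + b == 1) || ~~ adjacent ((p^-1)%g a) ((p^-1)%g b) ->
  f (p * tperm a b)%g = f p.

Lemma Peak_swap_invariant : swap_invariant (@Peak n).
Proof.
move=> p a b ab /orP[/eqP|nab]; first exact: Peak_swap01.
exact/eq_Peak/Des_swap.
Qed.

(** Without descents [p] is increasing, so [i <= p i] by induction from the bottom and [p i <= i] by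
    induction from the top. *)
Lemma perm_descent p : p != 1%g ->
  exists i j, j = i.+1 :> nat /\ p j < p i.
Proof.
move=> p1; have [/existsP[i /existsP[j /andP[/eqP]]]|] :=
  boolP [exists i : 'I_n, exists j : 'I_n, (j == i.+1 :> nat) && (p j < p i)].
  by exists i, j.
move=> /existsPn nodes; case/eqP: p1.
have incr i j : i < j -> p i < p j.
  case: j => j ltj /=; elim: j ltj => // j IH ltj; rewrite ltnS leq_eqVlt.
  have ltj' : j < n by apply: ltn_trans ltj.
  have lt_p : p (Ordinal ltj') < p (Ordinal ltj).
    have /existsPn/(_ (Ordinal ltj)) := nodes (Ordinal ltj').
    rewrite eqxx /= -leqNgt leq_eqVlt.
    case/orP=> [/eqP/val_inj/perm_inj/(congr1 val)/= e|//].
    by lia.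
  case/orP=> [/eqP eij|/(IH ltj')]; last by move/ltn_trans; apply.
  by have -> : i = Ordinal ltj' by apply: val_inj.
have ge_id i : i <= p i.
  case: i => i lti /=; elim: i lti => // i IH lti.
  have lti' : i < n by apply: ltn_trans lti.
  exact: leq_ltn_trans (IH lti') (incr (Ordinal lti') (Ordinal lti) _).
have le_id i : p i <= i.
  have [m] := ubnP (n - i); elim: m => // m IH in i *; rewrite ltnS => lem.
  have [lt_i|ge_i] := ltnP i.+1 n; last first.
    by rewrite -ltnS (leq_trans _ ge_i).
  have := IH (Ordinal lt_i); rewrite /= => /(_ ltac:(lia)).
  by have := incr i (Ordinal lt_i) (ltnSn _); lia.
by apply/permP=> i; rewrite perm1; apply/val_inj/eqP; rewrite eqn_leq le_id ge_id.
Qed.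

Variables (T : Type) (f : 'S_n -> T).
Hypothesis f_inv : swap_invariant f.

(* An exchange in p that removes an inversion of p^-1 q increases the inner
   product of p and q as words. *)
Lemma swap_invariant_eq_Des p q : Des p = Des q -> f p = f q.
Proof.
pose dot p := \sum_i p i * q i.
have dot_max r : dot r <= \sum_(i < n) n * n.
  by apply: leq_sum => i _; rewrite leq_mul // ltnW.
have [m] := ubnP (\sum_(i < n) n * n - dot p); elim: m => // m IH in p *.
rewrite ltnS => lem eqD.
have [/eqP e|/perm_descent[a [b [ba lt_ba]]]] := boolP ((p^-1 * q)%g == 1%g).
  by move/(canRL (mulKVg p)): e => ->; rewrite mulg1.
have ab := adjacentS ba; move: lt_ba; rewrite !permM => lt_ba.
(* At adjacent positions, the values [a] and [b] of [p] and the corresponding values of [q] would be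
   in opposite orders, contrary to [eqD]. *)
have nadj : ~~ adjacent ((p^-1)%g a) ((p^-1)%g b).
  apply/negP => /orP[/eqP e|/eqP e].
    have : (((p^-1)%g b) \in Des p) = (((p^-1)%g b) \in Des q) by rewrite eqD.
    rewrite !(mem_Des _ e) !permKV; lia.
  have : (((p^-1)%g a) \in Des p) = (((p^-1)%g a) \in Des q) by rewrite eqD.
  rewrite !(mem_Des _ e) !permKV; lia.
rewrite -(f_inv ab); last by rewrite nadj orbT.
apply: IH; last by rewrite Des_swap.
suff: dot p < dot (p * tperm a b)%g by have := dot_max (p * tperm a b)%g; lia.
have nab : (p^-1)%g b != (p^-1)%g a.
  by rewrite (inj_eq perm_inj) -val_eqE /=; lia.
rewrite /dot (bigD1 ((p^-1)%g a)) //= (bigD1 ((p^-1)%g b)) //=.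
rewrite [X in _ < X](bigD1 ((p^-1)%g a)) //= [X in _ < _ + X](bigD1 ((p^-1)%g b)) //=.
rewrite !permM !permKV tpermL tpermR.
rewrite [X in _ < _ + (_ + X)](eq_bigr (fun i => p i * q i)); first by nia.
move=> i /andP[ia ib]; rewrite permM tpermD //.
  by rewrite eq_sym; apply: contraNneq ia => <-; rewrite permK.
by rewrite eq_sym; apply: contraNneq ib => <-; rewrite permK.
Qed.

(* The hypotheses say that the values of p at i and j bottom out a valley: they
   can be lowered to 1 and 0 by exchanges preserving Des, and then swapped. *)
Lemma remove_descent p i j : j = i.+1 :> nat -> p j < p i ->
    (forall h, i = h.+1 :> nat -> p i < p h) ->
    (forall k, k = j.+1 :> nat -> p j < p k) ->
  exists q, [/\ f q = f p, Peak q = Peak p & Des q = Des p :\ i].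
Proof.
move=> ji; have [m] := ubnP (p i + p j); elim: m => // m IH in p *.
rewrite ltnS => lem lt_ji lt_h lt_k.
have ij := adjacentS ji.
(* Lowering the value at [x] by one decreases [p i + p j]: as [u] is not beside [x], it is not the
   value at the other of [i] and [j]. *)
have step x (u : 'I_n) : p x = u.+1 :> nat -> (x = i) \/ (x = j) ->
    ~~ adjacent x ((p^-1)%g u) ->
    exists q, [/\ f q = f p, Peak q = Peak p & Des q = Des p :\ i].
  move=> pxu xij nadj; have ab : adjacent (p x) u by rewrite adjacentC adjacentS.
  have nadj' : ~~ adjacent ((p^-1)%g (p x)) ((p^-1)%g u) by rewrite permK.
  have lt_s := lt_swap ab nadj'.
  have [||||q [fq Pq Dq]] := IH (p * tperm (p x) u)%g.
  - have nu : p i <> u /\ p j <> u.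
      by case: xij => ?; subst x; split => e; move: nadj pxu;
        rewrite -e ?permK ?ij ?(adjacentC j) ?ij // => _; lia.
    rewrite !permM; case: xij => ?; subst x; rewrite tpermL tpermD; try lia;
      apply/eqP => e; first [by case: nu; congruence
                          | by move: (congr1 val e) => /=; lia].
  - by rewrite lt_s // adjacentC.
  - by move=> h ih; rewrite lt_s ?lt_h // adjacentC adjacentS.
  - by move=> k kj; rewrite lt_s ?lt_k // adjacentS.
  exists q; split; first by rewrite fq f_inv // nadj' orbT.
    by rewrite Pq Peak_swap_invariant // nadj' orbT.
  by rewrite Dq Des_swap.
have pn x (y : nat) : y < p x -> y < n by move/ltn_trans; apply.
(* First [p j] is lowered to 0, then [p i] to 1. The next smaller value is never beside the position
   concerned: the neighbours hold larger values, except that [j], beside [i], holds 0 in the second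
   phase. *)
have [pj0|pj_gt0] := posnP (p j).
  have [pi1|pi_gt1] := leqP (p i) 1; last first.
    have lt_u : (p i).-1 < n by apply: (pn i); lia.
    apply: (step i (Ordinal lt_u)) => /=; [lia | by left |].
    apply/negP => /orP[]/eqP e.
      by have := lt_h _ e; rewrite permKV /=; lia.
    have ej : (p^-1)%g (Ordinal lt_u) = j by apply: val_inj => /=; lia.
    by move: pj0; rewrite -ej permKV /=; lia.
  have pi1' : p i = 1 :> nat by lia.
  have ab : adjacent (p i) (p j) by rewrite adjacentC adjacentS // pi1' pj0.
  have s01 : p i + p j == 1 by rewrite pi1' pj0.
  exists (p * tperm (p i) (p j))%g; split.
  - by rewrite f_inv // s01.
  - by rewrite Peak_swap_invariant // s01.
  apply/setP=> x; rewrite in_setD1.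
  have [->|xi] /= := eqVneq x i.
    by rewrite (mem_Des _ ji) !permM tpermL tpermR; lia.
  apply/DesP/DesP=> -[y yx]; rewrite !permM => lt; exists y => //; move: lt;
    rewrite ?permM lt_tperm // => -[/perm_inj ey /perm_inj ex];
    subst; move: xi; rewrite ?eqxx //; lia.
have lt_u : (p j).-1 < n by apply: (pn j); lia.
apply: (step j (Ordinal lt_u)) => /=; [lia | by right |].
apply/negP => /orP[]/eqP e.
  have ei : (p^-1)%g (Ordinal lt_u) = i by apply: val_inj => /=; lia.
  by move: lt_ji; rewrite -ei permKV /=; lia.
by have := lt_k _ e; rewrite permKV /=; lia.
Qed.

(* The largest descent that is not a peak ends a valley, so it can be removed. *)
Lemma reduce_to_peaks p :
  exists q, [/\ f q = f p, Peak q = Peak p & Des q = Peak p].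
Proof.
have [m] := ubnP #|Des p|; elim: m => // m IH in p *; rewrite ltnS => lem.
have [/eqP e|] := boolP (Des p == Peak p); first by exists p.
rewrite eqEsubset Peak_Des andbT => /subsetPn[i0 Di0 Pi0].
have i0P : i0 \in Des p :\: Peak p by rewrite in_setD Pi0.
case: (arg_maxnP (fun i : 'I_n => i : nat) i0P) => i /setDP[Di Pi] i_max.
have [j ji lt_ji] := DesP _ _ Di.
have neqp (x y : 'I_n) : x <> y :> nat -> p x <> p y :> nat.
  by move=> nxy /val_inj/perm_inj exy; apply: nxy; rewrite exy.
have [|k kj|q [fq Pq Dq]] := remove_descent ji lt_ji.
- move=> h ih; move: Pi; rewrite (mem_Peak p ih ji) lt_ji andbT.
  by have := neqp h i; lia.
(* Otherwise [j] would be a descent, and no peak since [p j < p i], against the maximality of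
   [i]. *)
- rewrite ltnNge; apply/negP => le_kj.
  suff /i_max : j \in Des p :\: Peak p by rewrite ji; lia.
  have lt_kj : p k < p j by have := neqp k j; lia.
  by rewrite in_setD (mem_Peak p ji kj) (mem_Des p kj); lia.
have [|r [fr Pr Dr]] := IH q.
  by apply: leq_trans lem; rewrite Dq [X in _ < X](cardsD1 i) Di.
by exists r; rewrite fr Pr Dr Pq.
Qed.

Lemma swap_invariant_eq_Peak p q : Peak p = Peak q -> f p = f q.
Proof.
have [p' [<- _ Dp]] := reduce_to_peaks p; have [q' [<- _ Dq]] := reduce_to_peaks q.
by move=> eqP; apply: swap_invariant_eq_Des; rewrite Dp Dq.
Qed.

End Swaps.

(** * Sums over the fibres of a map on a group *)

Section ClassSums.
Local Open Scope ring_scope.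
Variables (K : fieldType) (gT : finGroupType) (T : finType) (st : gT -> T).
Implicit Types (t : T) (x : group_alg K gT).

Definition class_sum t : group_alg K gT := \sum_(g | st g == t) ga_delta K g.

Lemma gaval_sum (I : Type) (r : seq I) (P : pred I) (F : I -> group_alg K gT) g :
  gaval (\sum_(i <- r | P i) F i) g = \sum_(i <- r | P i) gaval (F i) g.
Proof.
by apply: (big_morph (fun x : group_alg K gT => gaval x g)) => [x y|];
  rewrite ?gavalD // /gaval ffunE.
Qed.

Lemma gaval_class_sum t g : gaval (class_sum t) g = (st g == t)%:R.
Proof.
rewrite gaval_sum big_mkcond (bigD1 g) //= big1 => [|h hg].
  by rewrite gaval_delta eqxx addr0; case: ifP.
by rewrite gaval_delta (eq_sym g) (negPf hg) if_same.
Qed.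

Lemma gaval_scale_sum (c : T -> K) (r : seq T) g : uniq r ->
  gaval (\sum_(t <- r) c t *: class_sum t) g = if st g \in r then c (st g) else 0.
Proof.
move=> r_uniq; rewrite gaval_sum; under eq_bigr do rewrite gavalZ gaval_class_sum.
case: ifP => [gr|/negP ngr].
  rewrite (bigD1_seq (st g)) //= eqxx mulr1 big1 ?addr0 // => t.
  by rewrite eq_sym => /negPf->; rewrite mulr0.
rewrite big_seq big1 // => t tr; case: eqP => [gt|]; last by rewrite mulr0.
by case: ngr; rewrite gt.
Qed.

Lemma mem_class_sums (V : {vspace group_alg K gT}) x :
    (forall t, class_sum t \in V) ->
    (forall g h, st g = st h -> gaval x g = gaval x h) ->
  x \in V.
Proof.
move=> sV st_x.
(* The common coefficient of [x] on the fibre over [t]; the default 0 is for empty fibres, whose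
   class sums vanish. *)
pose c t := oapp (gaval x) 0 [pick g | st g == t].
have -> : x = \sum_t c t *: class_sum t.
  apply: gaP => g; rewrite gaval_scale_sum ?index_enum_uniq // mem_index_enum /c.
  by case: pickP => [h /eqP/st_x //|/(_ g)]; rewrite eqxx.
by apply: memv_suml => t _; apply/memvZ/sV.
Qed.

Variable A : {set T}.
Hypothesis stA : forall g, st g \in A.
Local Notation class_space := <<[seq class_sum t | t in A]>>%VS.

Lemma class_sum_mem t : class_sum t \in class_space.
Proof.
have [tA|ntA] := boolP (t \in A); first by apply/memv_span/image_f.
rewrite /class_sum big_pred0 ?mem0v // => g.
by apply: contraNF ntA => /eqP <-.
Qed.

(** Sums over empty fibres vanish, and those over nonempty ones are free because their supports are
    disjoint. *)
Lemma class_space_dim : \dim class_space = #|st @: setT|.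
Proof.
pose r := enum (st @: setT); pose X := [seq class_sum t | t <- r].
have -> : class_space = <<X>>%VS.
  apply/eqP; rewrite eqEsubv; apply/andP; split; apply/span_subvP => _ /mapP[t _ ->];
    last exact: class_sum_mem.
  have [tr|ntr] := boolP (t \in r); first by apply/memv_span/map_f.
  rewrite /class_sum big_pred0 ?mem0v // => g.
  by apply: contraNF ntr => /eqP <-; rewrite mem_enum imset_f.
suff /eqP -> : free X by rewrite size_map -cardE.
have szX : size X = size r by rewrite size_map.
have X_nth (i : 'I_(size X)) : X`_i = class_sum (nth (st 1%g) r i).
  by rewrite (nth_map (st 1%g)) // -szX.
apply/(freeP (X := in_tuple X)) => k k0 i.
have : nth (st 1%g) r i \in r by rewrite mem_nth // -szX.
rewrite mem_enum => /imsetP[g _ gi].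
(* Evaluation at a point [g] of the [i]-th fibre isolates the coefficient [k i]. *)
have /(congr1 (fun x : group_alg K gT => gaval x g)) := k0.
rewrite gaval_sum (bigD1 i) //= big1 => [|j ji];
  rewrite gavalZ X_nth gaval_class_sum -gi.
  by rewrite eqxx mulr1 addr0 /gaval ffunE.
by rewrite nth_uniq ?enum_uniq -?szX // val_eqE eq_sym (negPf ji) mulr0.
Qed.

End ClassSums.

(** * Counting the peak sets *)

Section PeakSets.

(** Bit sequences of length [m] without two consecutive [true], listed along the Fibonacci
    recursion: for [m >= 2], a leading [true] forces a [false] after it. *)
Fixpoint sparse_seqs m : seq bitseq :=
  match m with
  | 0 => [:: [::]]
  | 1 => [:: [:: false]; [:: true]]
  | (m'.+1 as m1).+1 =>
      map (cons false) (sparse_seqs m1)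
        ++ map (fun s => [:: true, false & s]) (sparse_seqs m')
  end.

Lemma size_sparse_seqs m : size (sparse_seqs m) = fib m.+2.
Proof.
suff [] : size (sparse_seqs m) = fib m.+2 /\ size (sparse_seqs m.+1) = fib m.+3 by [].
elim: m => // m [IH0 IH1]; split=> //.
by rewrite /= size_cat !size_map IH0 -[size _]/(size (sparse_seqs m.+1)) IH1.
Qed.

Definition sparse := sorted (fun b c => ~~ (b && c)).

Lemma mem_sparse_seqs m s : (s \in sparse_seqs m) = (size s == m) && sparse s.
Proof.
have cons_inj : injective (cons false) by move=> s1 s2 [].
have cons2_inj : injective (fun s => [:: true, false & s]) by move=> s1 s2 [].
have sparse_cons t : sparse (false :: t) = sparse t by case: t.
suff [] : (forall s, (s \in sparse_seqs m) = (size s == m) && sparse s) /\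
    (forall s, (s \in sparse_seqs m.+1) = (size s == m.+1) && sparse s) by [].
elim: m {s} => [|m [IH0 IH1]].
  by split=> [[]|[|[] []]] //.
split=> // s; rewrite mem_cat.
case: s => [|[|] s].
- by apply/orP=> -[]/mapP[].
- case: s => [|[|] s].
  + by apply/orP=> -[]/mapP[].
  + by rewrite /sparse /= andbF; apply/orP=> -[]/mapP[].
  rewrite (mem_map cons2_inj) IH0 -sparse_cons.
  by apply/orP/idP => [[/mapP[]//|]|]; [|right].
rewrite (mem_map cons_inj) IH1 sparse_cons.
by apply/orP/idP => [[|/mapP[]]//|]; left.
Qed.

Lemma sparse_seqs_uniq m : uniq (sparse_seqs m).
Proof.
have cons_inj : injective (cons false) by move=> s1 s2 [].
have cons2_inj : injective (fun s => [:: true, false & s]) by move=> s1 s2 [].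
suff [] : uniq (sparse_seqs m) /\ uniq (sparse_seqs m.+1) by [].
elim: m => // m [IH0 IH1]; split=> //.
rewrite [sparse_seqs _]/= cat_uniq !map_inj_uniq ?IH0 //.
rewrite -[(if _ is _.+1 then _ else _)]/(sparse_seqs m.+1) IH1 andbT /=.
by apply/hasPn => _ /mapP[t _ ->]; apply/negP => /mapP[].
Qed.

Variable n : nat.

Lemma Peak_exists (Q : pred nat) :
    (forall k, Q k -> 0 < k /\ k.+1 < n) -> (forall k, Q k -> ~~ Q k.+1) ->
  exists p : 'S_n, Peak p = [set i : 'I_n | Q i].
Proof.
move=> Q_range Q_sparse.
have Q0 : Q 0 = false by apply/negP => /Q_range[].
(* The witness swaps [k] and [k.+1] for each [k] in [Q]; by sparsity these transpositions are
   disjoint, so [h] is an involution. *)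
pose h k := if Q k then k.+1 else if Q k.-1 then k.-1 else k.
have h_lt (i : 'I_n) : h i < n.
  rewrite /h; case: ifP => [/Q_range[] //|_]; have := ltn_ord i.
  by case: ifP => _; lia.
have hK : involutive h.
  have h0 : h 0 = 0 by rewrite /h /= Q0.
  case=> [|k]; first by rewrite !h0.
  rewrite [h k.+1]/h /=; case: ifP => Qk.
    by rewrite /h /= (negPf (Q_sparse _ Qk)) Qk.
  by case: ifP => Qk'; rewrite /h /= ?Qk ?Qk'.
pose g i := Ordinal (h_lt i).
have g_inj : injective g by apply: (can_inj (g := g)) => i; apply: val_inj; apply: hK.
exists (perm g_inj); apply/setP=> i; rewrite [RHS]inE.
apply/PeakP/idP => [[h0 [j [ih ji _]]]|Qi].
  (* Outside [Q], [h i <= i < h i.+1], so there is no descent at [i]. *)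
  rewrite !permE /= ji /h /=; case: (boolP (Q i)) => //= nQi.
  by case: (Q i.+1); case: (Q i.-1) => /=; lia.
have [i_gt0 lt_i] := Q_range i Qi.
have lt_i1 : i.-1 < n by lia.
have nQi1 : Q i.-1 = false.
  by apply/negP => /Q_sparse; rewrite prednK // Qi.
have hi : h i = i.+1 by rewrite /h Qi.
have hi1 : h i.-1 <= i by rewrite /h nQi1; case: ifP => _; lia.
have hi2 : h i.+1 = i by rewrite /h (negPf (Q_sparse _ Qi)) /= Qi.
by exists (Ordinal lt_i1), (Ordinal lt_i); split; rewrite ?permE /=; lia.
Qed.

(* Position k of s tells whether k + 1 lies in the peak set. *)
Definition set_of_seq (s : bitseq) : {set 'I_n} :=
  [set i : 'I_n | (0 < i) && nth false s i.-1].

Lemma set_of_seq_inj : {in sparse_seqs (n - 2) &, injective set_of_seq}.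
Proof.
move=> s t; rewrite !mem_sparse_seqs => /andP[/eqP szs _] /andP[/eqP szt _] /setP eqst.
apply: (@eq_from_nth _ false); rewrite szs // => k lt_k.
have lt_k1 : k.+1 < n by lia.
by have := eqst (Ordinal lt_k1); rewrite !inE.
Qed.

(** Neighbouring positions cannot both be peaks, as each value would exceed the other; conversely
    [Peak_exists] realises every sparse set. *)
Lemma peak_setsE :
  (@Peak n) @: setT =i [seq set_of_seq s | s <- sparse_seqs (n - 2)].
Proof.
move=> P; apply/imsetP/mapP => [[p _ ->]|[s]].
  pose q k := [exists i : 'I_n, (i == k :> nat) && (i \in Peak p)].
  have qE (i : 'I_n) : q i = (i \in Peak p).
    apply/existsP/idP => [[j /andP[/eqP/val_inj -> //]]|iP].
    by exists i; rewrite eqxx.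
  exists (mkseq (fun k => q k.+1) (n - 2)).
    rewrite mem_sparse_seqs size_mkseq eqxx; apply/(sortedP false) => k.
    rewrite size_mkseq => lt_k; rewrite !nth_mkseq //; last by lia.
    apply/negP => /andP[/existsP[i /andP[/eqP ik /PeakP[h [j [ih ji _ lt_j]]]]]].
    case/existsP=> i' /andP[/eqP ik' /PeakP[h' [j' [ih' ji' lt_h' _]]]].
    have e1 : j = i' by apply: val_inj => /=; lia.
    have e2 : h' = i by apply: val_inj => /=; lia.
    by move: lt_j lt_h'; rewrite e1 e2; lia.
  apply/setP=> i; rewrite [RHS]inE.
  apply/idP/andP => [iP|[i_gt0]].
    have /PeakP[h [j [ih ji _ _]]] := iP.
    have lt_j := ltn_ord j.
    rewrite nth_mkseq; last by lia.
    by rewrite prednK ?qE; lia.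
  have [lt_i|ge_i] := ltnP i.-1 (n - 2); last by rewrite nth_default ?size_mkseq.
  by rewrite nth_mkseq // prednK // qE.
rewrite mem_sparse_seqs => /andP[/eqP szs /(sortedP false) s_sparse] ->.
have s_lt k : nth false s k -> k < n - 2.
  by case: (ltnP k (n - 2)) => // ge_k; rewrite nth_default ?szs.
have [k /andP[k_gt0 /s_lt lt_k]|k /andP[k_gt0 sk]|p Pp] :=
    Peak_exists (Q := fun k => (0 < k) && nth false s k.-1).
- by lia.
- apply/negP => /= sk1; have := s_sparse k.-1; rewrite prednK // szs.
  by move=> /(_ (s_lt _ sk1)); rewrite sk sk1.
by exists p.
Qed.

Lemma card_peak_sets : #|(@Peak n) @: setT| = fib n.
Proof.
rewrite (eq_card peak_setsE) (card_uniqP _).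
  (* For [n < 2] the subtraction truncates to 0, which agrees with [fib] because its first three
     values are equal. *)
  rewrite size_map size_sparse_seqs; case: n => [|[|m]] //.
  by rewrite subn2.
by rewrite map_inj_in_uniq ?sparse_seqs_uniq //; apply: set_of_seq_inj.
Qed.

End PeakSets.

(** * Products of descent class sums with peak class sums *)

Section LeftIdeal.
Local Open Scope ring_scope.
Variables (K : fieldType) (n : nat).
Implicit Types (D P : {set 'I_n}) (p t : 'S_n).

Lemma gaval_Des_sum_mul_Peak_sum D P t :
  gaval (Des_sum K D * Peak_sum K P) t =
    \sum_(p : 'S_n) (Des p == D)%:R * (Peak (p^-1 * t)%g == P)%:R.
Proof.
rewrite [LHS]gaval_mul; apply: eq_bigr => p _.
by rewrite !gaval_class_sum.
Qed.

Lemma Des_sum_mul_Peak_sum_swap D P :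
  swap_invariant (gaval (Des_sum K D * Peak_sum K P)).
Proof.
move=> t a b ab; rewrite !gaval_Des_sum_mul_Peak_sum => /orP[/eqP s01|nadj].
  by apply: eq_bigr => p _; rewrite mulgA Peak_swap01.
set c := (t^-1)%g a; set d := (t^-1)%g b; set s := tperm a b.
(* The values [a] and [b] of [p^-1 * t] stand at positions [p c] and [p d]. If these are adjacent,
   [phi] exchanges them as values of [p]; this keeps [Des p], since [c] and [d] are not adjacent,
   and [(phi p)^-1 * (t * s) = p^-1 * t]. *)
pose phi p := if adjacent (p c) (p d) then (tperm c d * p)%g else p.
have phiK : involutive phi.
  move=> p; rewrite /phi; case pcd: (adjacent (p c) (p d)); last by rewrite pcd.
  by rewrite !permM tpermL tpermR adjacentC pcd mulgA tperm2 mul1g.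
rewrite (reindex_inj (inv_inj phiK)); apply: eq_bigr => p _.
rewrite /phi; case: ifP => pcd.
  rewrite [(tperm c d * p)%g]conjgC tpermJ Des_swap ?permK ?/c ?/d ?nadj //.
  rewrite -tpermJ -conjgC -/c -/d.
  have ->: (t * s = tperm c d * t)%g by rewrite [RHS]conjgC tpermJ !permKV.
  by rewrite invMg tpermV -mulgA (mulgA (tperm c d)) tperm2 mul1g.
rewrite mulgA (@Peak_swap_invariant _ (p^-1 * t)%g) // orbC.
by rewrite invMg invgK !permM -/c -/d pcd.
Qed.

Lemma Peak_in_range p : Peak p \in powerset (Peak_range n).
Proof.
rewrite powersetE; apply/subsetP => i /PeakP[h [j [ih ji _ _]]].
by rewrite inE ih /= -ih -ji.
Qed.

Lemma Des_in_range p : Des p \in powerset (Des_range n).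
Proof.
by rewrite powersetE; apply/subsetP => i /DesP[j ji _]; rewrite inE -ji.
Qed.

Lemma mem_peak_space x : (forall p q, Peak p = Peak q -> gaval x p = gaval x q) ->
  x \in peak_space n K.
Proof. exact/mem_class_sums/class_sum_mem/Peak_in_range. Qed.

(** A peak class sum is constant on descent classes, since descents determine peaks. *)
Lemma peak_space_sub : (peak_space n K <= descent_algebra n K)%VS.
Proof.
apply/span_subvP => _ /mapP[P _ ->].
apply: (mem_class_sums (st := @Des n)) => [|p q eqD].
  exact/class_sum_mem/Des_in_range.
by rewrite !gaval_class_sum (eq_Peak eqD).
Qed.

(** By bilinearity it suffices to multiply generators, whose products are swap invariant and so
    constant on peak classes. *)
Lemma peak_space_left_mul :
  {in descent_algebra n K & peak_space n K, forall d x, d * x \in peak_space n K}.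
Proof.
move=> d x /(coord_span (X := in_tuple _)) -> /(coord_span (X := in_tuple _)) ->.
rewrite mulr_suml memv_suml // => i _; rewrite mulr_sumr memv_suml // => j _.
rewrite -scalerAl -scalerAr !memvZ //.
have /mapP[D _ ->] := mem_nth 0 (ltn_ord i).
have /mapP[P _ ->] := mem_nth 0 (ltn_ord j).
exact/mem_peak_space/swap_invariant_eq_Peak/Des_sum_mul_Peak_sum_swap.
Qed.

End LeftIdeal.

Theorem theorem1 (K : fieldType) (charK0 : [pchar K]%R =i pred0) (n : nat) :
  left_ideal_of (descent_algebra n K) (peak_space n K)
  /\ \dim (peak_space n K) = fib n.
Proof.
split; first by split; [apply: peak_space_sub | apply: peak_space_left_mul].
by rewrite -card_peak_sets -(class_space_dim K (@Peak_in_range n)).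
Qed.
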